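(* There exists a non-maximal ideal $\mathcal{I}$ on $\mathbb{N}$ for which there is no rich abstract upper density $\delta$ with $\mathcal{Z}_\delta=\mathcal{I}$.
   Context: An abstract upper density on $\mathbb{N}$ is a function $\delta:\mathcal{P}(\mathbb{N})\to[0,1]$ such that $\delta(\mathbb{N})=1$; $\delta(F)=0$ for every finite $F\subseteq\mathbb{N}$; $A\subseteq B$ implies $\delta(A)\le\delta(B)$; and $\delta(A\cup B)\le\delta(A)+\delta(B)$. It is rich if for every $r\in[0,1]$ there is $A\subseteq\mathbb{N}$ with $\delta(A)=r$. $\mathcal{Z}_\delta=\{A\subseteq\mathbb{N}:\delta(A)=0\}$. An ideal on $\mathbb{N}$ is a family $\mathcal{I}\subseteq\mathcal{P}(\mathbb{N})$ closed under finite unions and subsets, containing all finite subsets of $\mathbb{N}$, with $\mathbb{N}\notin\mathcal{I}$. An ideal is maximal if it is not properly contained in any other ideal on $\mathbb{N}$. *)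

(* Defs.v *)
From mathcomp Require Import all_boot all_order all_algebra.
From mathcomp Require Import all_classical all_reals.

Set Implicit Arguments.
Unset Strict Implicit.
Unset Printing Implicit Defensive.

Import Order.TTheory GRing.Theory Num.Theory.

Local Open Scope classical_set_scope.
Local Open Scope ring_scope.

Record abstract_upper_density (R : realType) (delta : set nat -> R) : Prop :=
  AbstractUpperDensity {
    aud_range : forall A : set nat, 0 <= delta A <= 1;
    aud_setT : delta setT = 1;
    aud_finite : forall F : set nat, finite_set F -> delta F = 0;
    aud_mono : forall A B : set nat, A `<=` B -> delta A <= delta B;
    aud_subadd : forall A B : set nat,
      delta (A `|` B) <= delta A + delta B }.

Definition rich (R : realType) (delta : set nat -> R) : Prop :=
  forall r : R, 0 <= r <= 1 -> exists A : set nat, delta A = r.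

Definition null_sets (R : realType) (delta : set nat -> R) : set (set nat) :=
  [set A | delta A = 0].

(* An ideal is nonempty because it contains the finite set [set0]; hence
   closure under binary unions gives closure under all finite unions. *)
Record ideal_on_nat (I : set (set nat)) : Prop := IdealOnNat {
  ideal_setU : forall A B : set nat, I A -> I B -> I (A `|` B);
  ideal_subset : forall A B : set nat, A `<=` B -> I B -> I A;
  ideal_finite : forall F : set nat, finite_set F -> I F;
  ideal_setT : ~ I setT }.

Definition maximal_ideal (I : set (set nat)) : Prop :=
  ideal_on_nat I /\ ~ (exists J : set (set nat), ideal_on_nat J /\ I `<` J).

(* Main.v *)
(** The intersection of two distinct maximal ideals has only four classes of
    sets modulo it.  An abstract upper density is constant on the classes
    modulo its null sets, so if its null sets are this intersection, it takes
    at most four values and is not rich.  The two maximal ideals come from one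
    free ultrafilter [U], transported to the even and to the odd numbers. *)

Require Import Defs.
From mathcomp Require Import all_boot all_order all_algebra.
From mathcomp Require Import all_classical all_reals.

Import Order.TTheory GRing.Theory Num.Theory.

Local Open Scope classical_set_scope.
Local Open Scope ring_scope.

Lemma exists_free_ultrafilter :
  exists U : set_system nat,
    UltraFilter U /\ forall F : set nat, finite_set F -> ~ U F.
Proof.
have [U [UU cofU]] := ultraFilterLemma frechet_properfilter_nat.
(* A finite member of [U] would be disjoint from its cofinite complement, also in [U]. *)
exists U; split=> // F finF UF.
have UFC : U (~` F) by apply: cofU; rewrite /frechet_filter/= setCK.
by have [x []] := filter_ex (filterI UF UFC).
Qed.

Lemma ultra_setU (T : Type) (U : set_system T) (A B : set T) :
  UltraFilter U -> U (A `|` B) -> U A \/ U B.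
Proof.
move=> UU UAB; have [UA|UAC] := in_ultra_setVsetC A UU; first by left.
by right; apply: filterS (filterI UAB UAC) => x [[]].
Qed.

(** The dual ideal of the image ultrafilter of [U] under [f]. *)
Definition ultra_ideal (U : set_system nat) (f : nat -> nat) : set (set nat) :=
  [set A | ~ U (f @^-1` A)].

(** Unions are handled by primality of [U]. Injectivity of [f] keeps preimages of finite sets
    finite, hence outside [U]. *)
Lemma ultra_idealP (U : set_system nat) (f : nat -> nat) :
  UltraFilter U -> (forall F : set nat, finite_set F -> ~ U F) ->
  injective f -> ideal_on_nat (ultra_ideal U f).
Proof.
move=> UU Ufree finj; split.
- by move=> A B nA nB; rewrite /ultra_ideal/= preimage_setU => /ultra_setU[].
- by move=> A B sAB nB UA; apply: nB; apply: filterS UA => x; exact: sAB.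
- move=> F finF; apply: Ufree; apply: finite_preimage => // x y _ _.
  exact: finj.
- by rewrite /ultra_ideal/= preimage_setT; apply; exact: filterT.
Qed.

Lemma ultra_ideal_setD (U : set_system nat) (f : nat -> nat)
    (A B : set nat) :
  ProperFilter U -> (U (f @^-1` A) -> U (f @^-1` B)) ->
  ultra_ideal U f (A `\` B).
Proof.
move=> FU UAB UD; have UA : U (f @^-1` A) by apply: filterS UD => x [].
by have [x [] [_]] := filter_ex (filterI UD (UAB UA)).
Qed.

Lemma ideal_on_nat_setI (I J : set (set nat)) :
  ideal_on_nat I -> ideal_on_nat J -> ideal_on_nat (I `&` J).
Proof.
move=> [IU IS IF IT] [JU JS JF _]; split.
- by move=> A B [IA JA] [IB JB]; split; [exact: IU|exact: JU].
- by move=> A B sAB [IB JB]; split; [exact: IS IB|exact: JS JB].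
- by move=> F finF; split; [exact: IF|exact: JF].
- by case.
Qed.

Lemma aud_null_setD (R : realType) (delta : set nat -> R) (A B : set nat) :
  abstract_upper_density delta -> delta (A `\` B) = 0 -> delta A <= delta B.
Proof.
move=> dens AB0; rewrite -[leRHS]addr0 -AB0.
apply: le_trans (aud_subadd dens _ _); apply: (aud_mono dens) => x Ax.
by have [Bx|nBx] := pselect (B x); [left|right].
Qed.

(** Pigeonhole: [delta] factors through [c], so it takes at most [#|K|] values. *)
Lemma finite_quotient_not_rich (R : realType) (K : finType)
    (delta : set nat -> R) (c : set nat -> K) :
  abstract_upper_density delta ->
  (forall A B, c A = c B -> delta (A `\` B) = 0) -> ~ rich delta.
Proof.
move=> dens cP richd; pose n := #|K|.
(* Richness supplies [n.+1] distinct values in [0, 1], one more than [K] has elements. *)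
have /choice[A AP] (i : 'I_n.+1) : exists A, delta A = i%:R / n.+1%:R.
  apply: richd; rewrite divr_ge0//= ler_pdivrMr ?ltr0n// mul1r ler_nat.
  exact: ltnW.
have cA_inj : injective (c \o A).
  move=> i j /= cij; apply/val_inj/eqP; rewrite -(eqr_nat R).
  have: delta (A i) = delta (A j).
    (* Equality of classes is symmetric, so both differences are null. *)
    by apply: le_anti; rewrite !aud_null_setD//; exact: cP.
  by rewrite !AP => /(mulIf _)->//; rewrite invr_neq0// pnatr_eq0.
by have := leq_card _ cA_inj; rewrite card_ord ltnn.
Qed.

Theorem theorem2p8 (R : realType) :
  exists I : set (set nat),
    [/\ ideal_on_nat I,
        ~ maximal_ideal I &
        ~ (exists delta : set nat -> R,
             [/\ abstract_upper_density delta,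
                 rich delta &
                 null_sets delta = I])].
Proof.
have [U [UU Ufree]] := exists_free_ultrafilter.
pose J0 := ultra_ideal U double; pose J1 := ultra_ideal U (succn \o double).
have J0P : ideal_on_nat J0 by apply: ultra_idealP => //; exact: double_inj.
have J1P : ideal_on_nat J1.
  by apply: ultra_idealP => // x y [] /double_inj.
exists (J0 `&` J1); split; first exact: ideal_on_nat_setI.
(* [J0] is strictly larger: the set of odd numbers lies in [J0] but not in [J1]. *)
- move=> [_]; apply; exists J0; split=> //; split; first exact: subIsetl.
  move=> sJ; have: J0 [set n | odd n].
    rewrite /J0/ultra_ideal/=; suff -> : double @^-1` [set n | odd n] = set0.
      exact: filter_not_empty.
    by rewrite -subset0 => n /=; rewrite odd_double.
  move=> /sJ[_]; rewrite /J1/ultra_ideal/=; apply.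
  by apply: filterS filterT => n _ /=; rewrite odd_double.
- move=> [delta [dens + null]].
  (* The class of [A] is coded by two booleans, telling which of the two image ultrafilters contain
     [A]. *)
  pose c A := (`[< U (double @^-1` A) >], `[< U ((succn \o double) @^-1` A) >]).
  apply: (finite_quotient_not_rich _ _ _ c dens) => A B [c0 c1].
  suff: null_sets delta (A `\` B) by [].
  by rewrite null; split; apply: ultra_ideal_setD => /asboolP;
    [rewrite c0|rewrite c1] => /asboolP.
Qed.
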